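(* Let $n\ge 1$, let $\mathbb{V}=\mathbb{R}^n$ with quadratic form $\Phi(v)=-\|v\|^2$ ($\|\cdot\|$ the Euclidean norm), and let $\rho$ be the twisted adjoint action $\rho_x(v)=\alpha(x)vx^{-1}$ of the Clifford–Lipschitz group $\Gamma_n$ on $\mathbb{V}$. Then the restriction $\rho:\mathrm{Pin}(n)\to \mathrm{O}(n)$ is a surjective group homomorphism with $\ker(\rho)=\{-1,1\}\cong\mathbb{Z}_2$. Moreover, the restriction $\rho:\mathrm{Spin}(n)\to\mathrm{SO}(n)$ is a surjective group homomorphism with the same kernel $\{-1,1\}\cong\mathbb{Z}_2$.
   Context: $\mathrm{Cl}_n$ is the Clifford algebra of $(\mathbb{V},\Phi)$: the universal unital associative real algebra with a linear map $i:\mathbb{V}\to\mathrm{Cl}_n$ satisfying $i(v)^2=\Phi(v)1$; the map $i$ is injective and $\mathbb{V}$ is identified with its image. $\alpha$ is the unique algebra automorphism of $\mathrm{Cl}_n$ with $\alpha(v)=-v$ for $v\in\mathbb{V}$; $t$ is the unique linear anti-automorphism with $t(v)=v$ for $v\in\mathbb{V}$; $\overline{x}=\alpha(t(x))$; $N(x)=x\overline{x}$. $\mathrm{Cl}_n^0=\{x:\alpha(x)=x\}$. $\mathrm{Cl}_n^*$ is the group of invertible elements, and $\Gamma_n=\{x\in\mathrm{Cl}_n^*:\alpha(x)vx^{-1}\in\mathbb{V}\ \forall v\in\mathbb{V}\}$, a group. $N$ restricts to a group homomorphism $\Gamma_n\to\mathbb{R}^*1$; $\mathrm{Pin}(n)$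 is its kernel, $\mathrm{Pin}(n)=\{x\in\Gamma_n: N(x)=1\}$, and $\mathrm{Spin}(n)=\mathrm{Pin}(n)\cap\mathrm{Cl}_n^0$. $\mathrm{O}(n)$ is the group of linear automorphisms of $\mathbb{V}$ preserving $\Phi$, and $\mathrm{SO}(n)$ its subgroup of elements of determinant $+1$. *)

(* Defs.v *)
From HB Require Import structures.
From mathcomp Require Import all_boot all_order all_algebra.
From mathcomp Require Import all_classical reals.
Set Implicit Arguments.
Unset Strict Implicit.
Unset Printing Implicit Defensive.
Import Order.TTheory GRing.Theory Num.Theory.
Local Open Scope classical_set_scope.
Local Open Scope ring_scope.

(* Groups as subsets [G] of an ambient type, with an explicit law and identity:
   Pin(n), Spin(n) live in the Clifford algebra, O(n), SO(n) among the self-maps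
   of V under composition. *)
Record is_group (T : Type) (G : set T) (mul : T -> T -> T) (e : T) : Prop :=
  IsGroup {
    group_id : G e;
    group_mul : forall x y, G x -> G y -> G (mul x y);
    group_assoc : forall x y z, G x -> G y -> G z ->
      mul x (mul y z) = mul (mul x y) z;
    group_idl : forall x, G x -> mul e x = x;
    group_idr : forall x, G x -> mul x e = x;
    group_inv : forall x, G x -> exists y, [/\ G y, mul x y = e & mul y x = e] }.

Record is_group_hom (S T : Type)
    (G : set S) (mulG : S -> S -> S) (eG : S)
    (H : set T) (mulH : T -> T -> T) (eH : T) (f : S -> T) : Prop :=
  IsGroupHom {
    hom_dom : is_group G mulG eG;
    hom_codom : is_group H mulH eH;
    hom_fun : set_fun G H f;
    hom_mul : forall x y, G x -> G y -> f (mulG x y) = mulH (f x) (f y) }.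

Definition hom_kernel (S T : Type) (G : set S) (eH : T) (f : S -> T) : set S :=
  [set x | G x /\ f x = eH].

Definition group_isomorphic (S T : Type)
    (G : set S) (mulG : S -> S -> S) (eG : S)
    (H : set T) (mulH : T -> T -> T) (eH : T) : Prop :=
  exists2 f : S -> T, is_group_hom G mulG eG H mulH eH f & set_bij G H f.

Section EuclideanForm.
Variables (R : realType) (n : nat).

(* The norm that the library puts on matrices is the sup norm. *)
Definition euclidean_norm (v : 'rV[R]_n) : R :=
  Num.sqrt (\sum_(j < n) v ord0 j ^+ 2).

Definition euclidean_form (v : 'rV[R]_n) : R := - euclidean_norm v ^+ 2.

End EuclideanForm.

Section OrthogonalGroup.
Variables (R : realType) (n : nat) (Phi : 'rV[R]_n -> R).

Definition orthogonal_group : set ('rV[R]_n -> 'rV[R]_n) :=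
  [set f | [/\ linear f, bijective f & forall v, Phi (f v) = Phi v]].

Definition special_orthogonal_group : set ('rV[R]_n -> 'rV[R]_n) :=
  [set f | orthogonal_group f /\ \det (lin1_mx f) = 1].

End OrthogonalGroup.

(* [Cl] with [i] is the Clifford algebra of [(V, Phi)], i.e. it satisfies the
   universal property among unital associative [R]-algebras. The carrier of an
   [algType] is nonzero; this loses nothing, since there is always exactly one
   morphism to the zero algebra. *)
Record is_clifford_algebra (R : realType) (V : lmodType R) (Phi : V -> R)
    (Cl : algType R) (i : {linear V -> Cl}) : Prop := IsCliffordAlgebra {
  clifford_sqr : forall v, i v ^+ 2 = (Phi v)%:A;
  clifford_universal : forall (B : algType R) (f : {linear V -> B}),
    (forall v, f v ^+ 2 = (Phi v)%:A) ->
    exists2 g : {lrmorphism Cl -> B}, (forall v, g (i v) = f v) &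
      forall h : {lrmorphism Cl -> B}, (forall v, h (i v) = f v) -> h =1 g }.

(* Requiring a [unitAlgType] only fixes the notation for inverses:
   [GRing.unit] is by definition the set of two-sided invertible elements. *)
Section CliffordGroups.
Variables (R : realType) (V : lmodType R) (Cl : unitAlgType R).
Variable i : {linear V -> Cl}.

Definition is_grade_involution (alpha : {lrmorphism Cl -> Cl}) : Prop :=
  bijective alpha /\ forall v, alpha (i v) = - i v.

Definition is_transposition (t : {linear Cl -> Cl}) : Prop :=
  [/\ bijective t, t 1 = 1, (forall x y, t (x * y) = t y * t x)
    & forall v, t (i v) = i v].

Variables (alpha : {lrmorphism Cl -> Cl}) (t : {linear Cl -> Cl}).

Definition clifford_conj (x : Cl) : Cl := alpha (t x).

Definition clifford_norm (x : Cl) : Cl := x * clifford_conj x.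

Definition even_part : set Cl := [set x | alpha x = x].

Definition lipschitz_group : set Cl :=
  [set x | x \is a GRing.unit /\ forall v, range i (alpha x * i v * x^-1)].

Definition pin_group : set Cl :=
  [set x | lipschitz_group x /\ clifford_norm x = 1].

Definition spin_group : set Cl := pin_group `&` even_part.

(* V is identified with its image under the injective map [i]: for [x] in the
   Lipschitz group, [twisted_adjoint x v] is the vector whose image under [i]
   is [alpha x * i v * x^-1]; the default value 0 is used only for other [x]. *)
Definition twisted_adjoint (x : Cl) (v : V) : V :=
  xget 0 [set w | i w = alpha x * i v * x^-1].

End CliffordGroups.

(* Main.v *)
Require Import Defs.
From HB Require Import structures.
From mathcomp Require Import all_boot all_order all_algebra.
From mathcomp Require Import all_classical reals.
From mathcomp Require Import ring lra.
Set Implicit Arguments.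
Unset Strict Implicit.
Unset Printing Implicit Defensive.
Import Order.TTheory GRing.Theory Num.Theory.
Local Open Scope classical_set_scope.
Local Open Scope ring_scope.

(** The kernel: since [i e_j ^+ 2 = -1], an element with [alpha x * v = v * x]
    for all vectors [v] is fixed by every [T_j : x |-> - e_j * alpha x * e_j],
    and [T_j] multiplies a word in the basis vectors by [(-1) ^+ m], with [m]
    the number of letters [e_j]. The words span the algebra, so the product of
    the [1 + T_j] maps everything to combinations of words with all letters
    even, which are scalars. Hence [x] is a scalar, and [N x = 1] makes it [1]
    or [-1]; no linear independence of the words is needed.

    The image: a unit vector [u] lies in Pin and acts by the reflection in [u],
    and reflections generate O(n) (Cartan-Dieudonne). Each reflection has
    determinant [-1] and each vector is odd, so [alpha x = det (rho x) *: x] on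
    Pin, which identifies Spin with the preimage of SO(n). *)

(** * Generation by vectors *)

Section Generation.
Variables (R : realType) (V : lmodType R) (Phi : V -> R).
Variables (Cl : algType R) (i : {linear V -> Cl}).
Hypothesis Cl_clifford : is_clifford_algebra Phi i.
Variable P : Cl -> Prop.
Hypothesis P1 : P 1.
Hypothesis Plin : forall a x y, P x -> P y -> P (a *: x + y).
Hypothesis Pmul : forall x y, P x -> P y -> P (x * y).
Hypothesis Pi : forall v, P (i v).

Let S : {pred Cl} := fun x => `[< P x >].

Let S_closed : GRing.subsemialg_closed S.
Proof.
apply: GRing.subalg_closed_semi; split.
- exact/asboolP.
- by move=> a x y /asboolP ? /asboolP ?; apply/asboolP/Plin.
- by move=> x y /asboolP ? /asboolP ?; apply/asboolP/Pmul.
Qed.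

(** The elements satisfying [P] form an algebra of their own, which can serve as target in the
    universal property. *)
Let subalg : Type := {x : Cl | S x}.
HB.instance Definition _ := [isSub of subalg for (@sval Cl S)].
HB.instance Definition _ := [Choice of subalg by <:].
HB.instance Definition _ :=
  GRing.SubChoice_isSubAlgebra.Build R Cl S subalg S_closed.

Let j (v : V) : subalg := exist _ (i v) (asboolT (Pi v)).

Let j_linear : linear j.
Proof. by move=> a u v; apply: val_inj; rewrite /= linearP. Qed.

HB.instance Definition _ :=
  GRing.isLinear.Build R V subalg *:%R j j_linear.

Let incl (y : subalg) : Cl := sval y.

Let incl_linear : linear incl. Proof. by []. Qed.
Let incl_multiplicative : monoid_morphism incl. Proof. by []. Qed.

HB.instance Definition _ :=
  GRing.isLinear.Build R subalg Cl *:%R incl incl_linear.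
HB.instance Definition _ :=
  GRing.isMonoidMorphism.Build subalg Cl incl incl_multiplicative.

(* Uniqueness in the universal property forces the composite
   [Cl -> subalg -> Cl] to be the identity. *)
Lemma clifford_algebra_ind x : P x.
Proof.
have j_sqr v : (j v : subalg) ^+ 2 = (Phi v)%:A.
  by apply: val_inj; exact: (clifford_sqr Cl_clifford v).
have [g gE _] := clifford_universal Cl_clifford j_sqr.
have [h _ h_uniq] := clifford_universal Cl_clifford (clifford_sqr Cl_clifford).
have -> : x = incl (g x).
  rewrite -[LHS]/((idfun : {lrmorphism Cl -> Cl}) x).
  rewrite -[RHS]/((incl \o g : {lrmorphism Cl -> Cl}) x).
  by rewrite !h_uniq // => v; rewrite /= gE.
apply/asboolP; exact: (svalP (g x)).
Qed.
End Generation.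

(** * Reflections and the Cartan-Dieudonne theorem *)

Section EuclideanGeometry.
Variables (R : realType) (n : nat).
Implicit Types (u v w : 'rV[R]_n) (f g : 'rV[R]_n -> 'rV[R]_n).

(** * The Euclidean inner product and reflections *)

Definition dot u v : R := (u *m v^T) 0 0.

Lemma dotE u v : dot u v = \sum_j u 0 j * v 0 j.
Proof. by rewrite /dot mxE; apply: eq_bigr => j _; rewrite mxE. Qed.

Lemma dotC u v : dot u v = dot v u.
Proof. by rewrite !dotE; apply: eq_bigr => j _; rewrite mulrC. Qed.

Lemma dotDl u v w : dot (u + v) w = dot u w + dot v w.
Proof. by rewrite /dot mulmxDl mxE. Qed.

Lemma dotZl a u v : dot (a *: u) v = a * dot u v.
Proof. by rewrite /dot -scalemxAl mxE. Qed.

Lemma dotNl u v : dot (- u) v = - dot u v.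
Proof. by rewrite -scaleN1r dotZl mulN1r. Qed.

Lemma dotBl u v w : dot (u - v) w = dot u w - dot v w.
Proof. by rewrite dotDl dotNl. Qed.

Lemma dotDr u v w : dot u (v + w) = dot u v + dot u w.
Proof. by rewrite dotC dotDl !(dotC _ u). Qed.

Lemma dotZr a u v : dot u (a *: v) = a * dot u v.
Proof. by rewrite dotC dotZl dotC. Qed.

Lemma dotBr u v w : dot u (v - w) = dot u v - dot u w.
Proof. by rewrite dotC dotBl !(dotC _ u). Qed.

Lemma dot_delta j k :
  dot (delta_mx 0 j : 'rV[R]_n) (delta_mx 0 k) = (j == k)%:R.
Proof. by rewrite /dot trmx_delta mul_delta_mx_cond; case: eqP => _; rewrite mxE. Qed.

Lemma dot_ge0 u : 0 <= dot u u.
Proof. by rewrite dotE sumr_ge0 // => j _; rewrite -expr2 sqr_ge0. Qed.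

Lemma dot_eq0 u : (dot u u == 0) = (u == 0).
Proof.
apply/idP/eqP => [|->]; last by rewrite /dot mul0mx mxE.
rewrite dotE psumr_eq0 => [/allP u0|j _]; last by rewrite -expr2 sqr_ge0.
apply/rowP => j; rewrite mxE; apply/eqP.
by have := u0 j (mem_index_enum j); rewrite mulf_eq0 orbb.
Qed.

Lemma euclidean_formE u : euclidean_form u = - dot u u.
Proof.
rewrite /euclidean_form /euclidean_norm sqr_sqrtr; last first.
  by rewrite sumr_ge0 // => j _; rewrite sqr_ge0.
by rewrite dotE; under eq_bigr do rewrite expr2.
Qed.

Lemma mul_rV_linear f v : linear f -> v *m lin1_mx f = f v.
Proof.
move=> f_lin; pose fL : {linear 'rV[R]_n -> 'rV[R]_n} :=
  HB.pack f (GRing.isLinear.Build _ _ _ _ f f_lin).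
exact: (mul_rV_lin1 fL).
Qed.

(** For a unit vector [u] this is the reflection in the hyperplane orthogonal to [u]. *)
Definition reflection u v := v - (2 * dot u v) *: u.

Lemma reflection_linear u : linear (reflection u).
Proof.
move=> a v w; rewrite /reflection dotDr dotZr.
rewrite scalerBr scalerA addrACA -opprD -scalerDl; congr (_ - _ *: _).
ring.
Qed.

Lemma reflection_dot u v w : dot u u = 1 ->
  dot (reflection u v) (reflection u w) = dot v w.
Proof.
move=> u1; rewrite /reflection !(dotBl, dotBr, dotZl, dotZr) u1 (dotC v u).
ring.
Qed.

Lemma reflectionK u : dot u u = 1 -> involutive (reflection u).
Proof.
move=> u1 v; rewrite {1}/reflection /reflection dotBr dotZr u1.
rewrite -addrA -opprD -scalerDl [X in X *: _](_ : _ = 0) ?scale0r ?subr0 //.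
ring.
Qed.

Lemma det_reflection u : dot u u = 1 -> \det (lin1_mx (reflection u)) = -1.
Proof.
move=> u1.
have -> : lin1_mx (reflection u) = 1%:M - 2%:R *: (u^T *m u).
  apply/row_matrixP => k; rewrite !rowE mul_rV_linear ?mulmxBr ?mulmx1; last first.
    exact: reflection_linear.
  rewrite /reflection -scalemxAr mulmxA; congr (_ - _).
  by rewrite dotC [_ *m u^T]mx11_scalar mul_scalar_mx scalerA.
(* [A] and [1 - 2 * dot u u = -1] are the two Schur complements of the same
   block matrix, written [L *m U] and [U' *m L']. *)
set A := 1%:M - _.
pose L : 'M_(1 + n) := block_mx 1%:M 0 (2%:R *: u^T) 1%:M.
pose U : 'M_(1 + n) := block_mx 1%:M u 0 A.
pose U' : 'M_(1 + n) := block_mx 1%:M u 0 1%:M.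
pose L' : 'M_(1 + n) := block_mx (- 1%:M) 0 (2%:R *: u^T) 1%:M.
have LU : L *m U = U' *m L'.
  rewrite /L /U /U' /L' !mulmx_block.
  rewrite !(mul1mx, mulmx1, mul0mx, mulmx0, addr0, add0r) /A.
  rewrite -scalemxAl [2 *: _ + _]addrC subrK -scalemxAr [u *m u^T]mx11_scalar.
  rewrite -/(dot u u) u1; congr block_mx.
  by rewrite scaler_nat mulr2n addrA addNr add0r.
have := congr1 determinant LU.
rewrite !det_mulmx det_lblock det_ublock det_ublock det_lblock !det1 !mul1r.
by move=> ->; rewrite det_mx11 !mxE mulr1.
Qed.

(** Bijectivity is left out and the inner product replaces the quadratic form; [orthogonal_groupP]
    recovers O(n). *)
Definition is_isometry f := linear f /\ forall u v, dot (f u) (f v) = dot u v.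

Lemma is_isometry_id : is_isometry id.
Proof. by split. Qed.

Lemma is_isometry_comp f g :
  is_isometry f -> is_isometry g -> is_isometry (f \o g).
Proof.
move=> [f_lin f_dot] [g_lin g_dot]; split=> [a u v|u v] /=.
  by rewrite g_lin f_lin.
by rewrite f_dot g_dot.
Qed.

Lemma is_isometry_reflection u : dot u u = 1 -> is_isometry (reflection u).
Proof.
by move=> u1; split=> [|v w]; [exact: reflection_linear|exact: reflection_dot].
Qed.

(** The rows of [A] are orthonormal, and a one-sided inverse of a square matrix is two-sided. *)
Lemma is_isometry_bij f : is_isometry f -> bijective f.
Proof.
move=> [f_lin f_dot]; pose A := lin1_mx f.
have fE v : f v = v *m A by rewrite mul_rV_linear.
have AAT : A *m A^T = 1%:M.
  apply/matrixP => j k; rewrite [RHS]mxE -dot_delta -f_dot !fE -!rowE /dot.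
  by rewrite !mxE; apply: eq_bigr => l _; rewrite !mxE.
exists (fun v => v *m A^T) => v; rewrite fE -mulmxA ?AAT ?mulmx1 //.
by rewrite (mulmx1C AAT) mulmx1.
Qed.

(** Polarization: expand the hypothesis at [u + v]. *)
Lemma is_isometry_sqr f :
  linear f -> (forall v, dot (f v) (f v) = dot v v) -> is_isometry f.
Proof.
move=> f_lin f_dot.
have fD u v : f (u + v) = f u + f v by rewrite -[u]scale1r f_lin !scale1r.
split=> // u v; have := f_dot (u + v).
rewrite fD !(dotDl, dotDr) !f_dot (dotC v u) (dotC (f v)); lra.
Qed.

Lemma orthogonal_groupP f :
  orthogonal_group (@euclidean_form R n) f <-> is_isometry f.
Proof.
split=> [[f_lin _ f_Phi]|f_iso]; last first.
  have [f_lin f_dot] := f_iso; split=> //; first exact: is_isometry_bij.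
  by move=> v; rewrite !euclidean_formE f_dot.
apply: is_isometry_sqr => // v; apply: oppr_inj.
by rewrite -!euclidean_formE.
Qed.

Lemma is_group_orthogonal :
  is_group (orthogonal_group (@euclidean_form R n)) comp id.
Proof.
split=> //.
- exact/orthogonal_groupP/is_isometry_id.
- move=> f g /orthogonal_groupP f_iso /orthogonal_groupP g_iso.
  exact/orthogonal_groupP/is_isometry_comp.
- move=> f /orthogonal_groupP[f_lin f_dot].
  have [g fK gK] := is_isometry_bij (conj f_lin f_dot).
  exists g; split; last 2 first.
  + exact/funext.
  + exact/funext.
  apply/orthogonal_groupP; split=> [a u v|u v]; last by rewrite -f_dot !gK.
  by apply: (can_inj fK); rewrite f_lin !gK.
Qed.

Lemma lin1_mx_comp f g : linear f -> linear g ->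
  lin1_mx (f \o g) = lin1_mx g *m lin1_mx f.
Proof.
move=> f_lin g_lin; apply/row_matrixP => k.
rewrite !rowE mulmxA !mul_rV_linear // => a u v /=.
by rewrite g_lin f_lin.
Qed.

Lemma lin1_mx_id : lin1_mx (id : 'rV[R]_n -> 'rV[R]_n) = 1%:M.
Proof. by apply/row_matrixP => k; rewrite !rowE mul_rV_linear ?mulmx1. Qed.

Lemma is_group_special_orthogonal :
  is_group (special_orthogonal_group (@euclidean_form R n)) comp id.
Proof.
have [O1 OM _ _ _ OV] := is_group_orthogonal.
split=> //.
- by split=> //; rewrite lin1_mx_id det1.
- move=> f g [fO fdet] [gO gdet]; split; first exact: OM.
  case: (fO) (gO) => f_lin _ _ [g_lin _ _].
  by rewrite lin1_mx_comp // det_mulmx fdet gdet mulr1.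
- move=> f [fO fdet]; have [g [gO fg gf]] := OV f fO; exists g; split=> //.
  split=> //; case: (fO) (gO) => f_lin _ _ [g_lin _ _].
  by rewrite -[LHS]mulr1 -fdet -det_mulmx -lin1_mx_comp // fg lin1_mx_id det1.
Qed.

(** * Factorization of isometries into reflections *)

Definition reflections (us : seq 'rV[R]_n) : 'rV[R]_n -> 'rV[R]_n :=
  foldr (fun u f => reflection u \o f) id us.

Definition unit_vectors (us : seq 'rV[R]_n) := all (fun u => dot u u == 1) us.

Lemma is_isometry_reflections us :
  unit_vectors us -> is_isometry (reflections us).
Proof.
elim: us => [|u us IHus] /=; first by move=> _; exact: is_isometry_id.
case/andP => /eqP u1 /IHus; apply: is_isometry_comp.
exact: is_isometry_reflection.
Qed.

Lemma det_reflections us : unit_vectors us ->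
  \det (lin1_mx (reflections us)) = (-1) ^+ size us.
Proof.
elim: us => [|u us IHus] /=; first by rewrite lin1_mx_id det1.
case/andP => /eqP u1 us1; rewrite lin1_mx_comp; last 2 first.
- exact: reflection_linear.
- exact: (is_isometry_reflections us1).1.
by rewrite det_mulmx IHus // det_reflection // exprSr.
Qed.

(* The witness is the unit vector in the direction [v - w]. *)
Lemma reflection_between v w : dot v v = dot w w -> v != w ->
  exists u, [/\ dot u u = 1, reflection u v = w &
    forall z, dot v z = dot w z -> reflection u z = z].
Proof.
move=> vw v_neq_w; pose d := v - w; pose c := Num.sqrt (dot d d).
have d_gt0 : 0 < dot d d by rewrite lt_neqAle eq_sym dot_eq0 subr_eq0 v_neq_w dot_ge0.
have c2 : c * c = dot d d by rewrite -expr2 sqr_sqrtr // ltW.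
have c0 : c != 0 by rewrite gt_eqF // sqrtr_gt0.
(* Equal norms of [v] and [w] give this, so the reflection subtracts exactly [d] from [v]. *)
have d_v : 2 * dot d v = dot d d.
  by rewrite /d !(dotBl, dotBr) (dotC w v) -vw; ring.
exists (c^-1 *: d); split.
- by rewrite dotZl dotZr -c2; field.
- rewrite /reflection dotZl scalerA.
  rewrite [X in X *: _](_ : _ = 1); first by rewrite scale1r /d opprB addrC subrK.
  by rewrite mulrCA d_v -c2; field.
- move=> z vz; rewrite /reflection dotZl /d dotBl vz subrr !mulr0 scale0r.
  by rewrite subr0.
Qed.

(** Induction on a bound [k] from which on [g] fixes all basis vectors. One reflection, taking [g e]
    back to [e] for the last basis vector [e] possibly moved, lowers the bound. *)
Lemma cartan_dieudonne f : is_isometry f ->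
  exists2 us, unit_vectors us & f = reflections us.
Proof.
suff fix_case k g : is_isometry g ->
    (forall j : 'I_n, (k <= j)%N -> g (delta_mx 0 j) = delta_mx 0 j) ->
    exists2 us, unit_vectors us & g = reflections us.
  by move=> f_iso; apply: (fix_case n) => // j; rewrite leqNgt ltn_ord.
elim: k g => [|k IHk] g g_iso g_fix.
  exists [::] => //; apply/funext => v.
  have [g_lin _] := g_iso.
  rewrite -(mul_rV_linear v g_lin) -[RHS]mulmx1; congr (_ *m _).
  by apply/row_matrixP => j; rewrite !rowE mul_rV_linear // mulmx1 g_fix.
(* For [n <= k] no basis vector has index [k], so the smaller bound holds vacuously. *)
have [k_ge_n|k_lt_n] := leqP n k.
  apply: IHk => // j k_le_j.
  by have := leq_trans k_ge_n k_le_j; rewrite leqNgt ltn_ord.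
pose j0 := Ordinal k_lt_n; pose e : 'rV[R]_n := delta_mx 0 j0.
have step h : is_isometry h -> h e = e ->
    (forall j : 'I_n, (k < j)%N -> h (delta_mx 0 j) = delta_mx 0 j) ->
    exists2 us, unit_vectors us & h = reflections us.
  move=> h_iso he h_fix; apply: IHk => // j; rewrite leq_eqVlt.
  case/predU1P => [kj|]; last exact: h_fix.
  by rewrite (_ : j = j0) //; apply/val_inj.
have [ge|ge] := eqVneq (g e) e; first exact: step.
have [g_lin g_dot] := g_iso.
have [u [u1 u_ge u_fix]] := reflection_between (g_dot e e) ge.
have [us us1 gE] : exists2 us, unit_vectors us & reflection u \o g = reflections us.
  apply: step => //; first exact: is_isometry_comp (is_isometry_reflection u1) _.
  (* As [g] fixes this basis vector and preserves [dot], the vector pairs equally with [g e] and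
     [e], so the new reflection fixes it too. *)
  move=> j k_lt_j /=; rewrite g_fix // u_fix //.
  by rewrite -[in LHS](g_fix j) // g_dot.
exists (u :: us); first by rewrite /= u1 eqxx.
by apply/funext => v /=; rewrite -gE /= reflectionK.
Qed.

End EuclideanGeometry.

(** * The twisted centralizer of the vectors *)

Section CliffordAlgebra.
Variables (R : realType) (n : nat) (Cl : algType R).
Variable i : {linear 'rV[R]_n -> Cl}.
Hypothesis Cl_clifford : is_clifford_algebra (@euclidean_form R n) i.

Lemma clifford_mul_vector u : i u * i u = (- dot u u)%:A.
Proof. by rewrite -euclidean_formE -(clifford_sqr Cl_clifford) expr2. Qed.

Lemma clifford_anticomm u v : i u * i v + i v * i u = (- (2 * dot u v))%:A.
Proof.
have := clifford_mul_vector (u + v).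
rewrite linearD mulrDl !mulrDr !clifford_mul_vector.
rewrite !(dotDl, dotDr) (dotC v u) => uv.
apply: (addrI (- dot u u)%:A); apply: (addIr (- dot v v)%:A).
by rewrite [_ + (_ + _)]addrA -[LHS]addrA uv -!scalerDl; congr (_ *: _); ring.
Qed.

(** The form is anisotropic: a vector killed by [i] has square zero, hence norm zero, since [1] is
    nonzero in [Cl]. *)
Lemma clifford_inj : injective i.
Proof.
move=> u v uv; apply/eqP; rewrite -subr_eq0 -dot_eq0 -oppr_eq0.
have := clifford_mul_vector (u - v); rewrite linearB uv subrr mul0r.
by move=> /esym/eqP; rewrite scaler_eq0 oner_eq0 orbF.
Qed.

(** * Words in the basis vectors *)

Let e j : Cl := i (delta_mx 0 j).

Let e_sqr j : e j * e j = -1.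
Proof. by rewrite clifford_mul_vector dot_delta eqxx scaleN1r. Qed.

Let e_anticomm j k : j != k -> e j * e k = - (e k * e j).
Proof.
move=> jk; apply/eqP; rewrite -addr_eq0 clifford_anticomm dot_delta (negPf jk).
by rewrite mulr0 oppr0 scale0r.
Qed.

(** Letters may repeat and come in any order, so left multiplication by a basis vector yields a word
    again. *)
Definition basis_word (w : seq 'I_n) : Cl := \prod_(j <- w) i (delta_mx 0 j).

Let word_cons j w : basis_word (j :: w) = e j * basis_word w.
Proof. exact: big_cons. Qed.

(** [L] need not be closed under products, so the induction over [Cl] is run on another property of
    [y]: left multiplication by [y] preserves the span of the words. Then [x] is [x] times the empty
    word. *)
Lemma basis_word_span (L : Cl -> Prop) :
  L 0 -> (forall a x y, L x -> L y -> L (a *: x + y)) ->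
  (forall w, L (basis_word w)) -> forall x, L x.
Proof.
pose linear_pred (M : Cl -> Prop) :=
  M 0 /\ forall a x y, M x -> M y -> M (a *: x + y).
move=> L0 L_lin L_word x.
(* The span is the intersection of all linear predicates containing the words. *)
pose span y := forall M, linear_pred M -> (forall w, M (basis_word w)) -> M y.
suff: span x by apply.
have span_lin : linear_pred span.
  split=> [M []//|a y z y_span z_span M M_lin M_word].
  by have [_] := M_lin; apply; [exact: y_span|exact: z_span].
have span_e j y : span y -> span (e j * y).
  move=> /(_ (fun z => span (e j * z))); apply=> [|w]; last first.
    by rewrite -word_cons => M _; apply.
  split=> [|a z z']; first by rewrite mulr0; exact: span_lin.1.
  by rewrite mulrDr -scalerAr; exact: span_lin.2.
suff span_mul y z : span z -> span (y * z).
  rewrite -[x]mulr1; apply: span_mul => M _ /(_ [::]).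
  by rewrite /basis_word big_nil.
elim/(clifford_algebra_ind Cl_clifford): y z
  => [z|a y y' IHy IHy' z z_span|y y' IHy IHy' z z_span|v z z_span].
- by rewrite mul1r.
- rewrite mulrDl -scalerAl; apply: span_lin.2; [exact: IHy|exact: IHy'].
- by rewrite -mulrA; apply: IHy; exact: IHy'.
- rewrite [v]row_sum_delta linear_sum mulr_suml.
  elim/big_ind: _ => [|y y'|j _]; first exact: span_lin.1.
    by move=> y_span y'_span; rewrite -[y]scale1r; exact: span_lin.2.
  rewrite linearZ -scalerAl -[_ *: _]addr0.
  by apply: span_lin.2; [exact: span_e|exact: span_lin.1].
Qed.

(** Induction on length: the first letter occurs again, is moved next to that occurrence at the cost
    of a scalar, and the pair contributes [-1]. Parities of counts are unchanged. *)
Lemma basis_word_sqr_count w :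
  (forall j, ~~ odd (count_mem j w)) -> exists c : R, basis_word w = c%:A.
Proof.
have e_word j u : exists c : R, e j * basis_word u = c *: (basis_word u * e j).
  elim: u => [|k u [c IHu]].
    by exists 1; rewrite /basis_word big_nil mulr1 mul1r scale1r.
  rewrite word_cons; have [<-|jk] := eqVneq j k.
    by exists c; rewrite {1}IHu -scalerAr mulrA.
  exists (- c); rewrite mulrA e_anticomm // mulNr.
  by rewrite -(mulrA _ _ (basis_word u)) IHu -scalerAr scaleNr mulrA.
have [m] := ubnP (size w); elim: m w => // m IHm [|j w] /= w_size w_even.
  by exists 1; rewrite /basis_word big_nil scale1r.
have j_in_w: j \in w.
  have := w_even j; rewrite eqxx /= negbK -has_pred1 has_count.
  by case: (count _ _).
case/splitPr: j_in_w w_size w_even => u v w_size w_even.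
have [c ec] := e_word j u.
have [|k|d uv] := IHm (u ++ v).
- by move: w_size; rewrite !size_cat /= addnS ltnS => /ltnW.
- have := w_even k; rewrite !count_cat /= !oddD.
  by case: (j == k); rewrite /= ?addbN ?negbK //=.
(* [c] comes from moving [e j] past [u], [d] from the shorter word, the sign from the square of
   [e j]. *)
exists (- (c * d)).
rewrite word_cons /basis_word big_cat big_cons /= -!/(basis_word _).
rewrite mulrA ec -scalerAl -mulrA (mulrA (i _)) -/(e j) e_sqr mulN1r mulrN.
rewrite /basis_word -big_cat -/(basis_word _) uv.
by rewrite scalerN scalerA scaleNr.
Qed.

(** * The grade involution and averaging over sign changes *)

Variable alpha : {lrmorphism Cl -> Cl}.
Hypothesis alpha_i : forall v, alpha (i v) = - i v.

(** Both [alpha \o alpha] and the identity extend [i], so uniqueness in the universal property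
    applies. *)
Lemma grade_involutionK : involutive alpha.
Proof.
have [g _ g_uniq] := clifford_universal Cl_clifford (clifford_sqr Cl_clifford).
move=> x; rewrite -[RHS]/((idfun : {lrmorphism Cl -> Cl}) x).
rewrite -[LHS]/((alpha \o alpha : {lrmorphism Cl -> Cl}) x).
by rewrite !g_uniq //= => v; rewrite alpha_i raddfN /= alpha_i opprK.
Qed.

(** As [- e j] is inverse to [e j], this is conjugation of [alpha x] by [e j]: the automorphism
    extending the reflection in the [j]-th basis vector. *)
Definition twisted_conj j x : Cl := - (e j * alpha x * e j).

Lemma twisted_conj_linear j : linear (twisted_conj j).
Proof.
move=> a x y; rewrite /twisted_conj linearP mulrDr mulrDl -scalerAr -scalerAl.
by rewrite opprD scalerN.
Qed.

Lemma twisted_conjZ j a x : twisted_conj j (a *: x) = a *: twisted_conj j x.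
Proof.
by rewrite /twisted_conj linearZ -scalerAr -scalerAl scalerN.
Qed.

Lemma twisted_conj_word j w :
  twisted_conj j (basis_word w) = (-1) ^+ count_mem j w *: basis_word w.
Proof.
elim: w => [|k w IHw].
  by rewrite /twisted_conj /basis_word big_nil rmorph1 mulr1 e_sqr opprK scale1r.
(* [alpha] gives one sign, and moving [e k] past [e j] gives a second one exactly when [k != j]. *)
rewrite word_cons; have -> : twisted_conj j (e k * basis_word w) =
    (-1) ^+ (k == j) *: (e k * twisted_conj j (basis_word w)).
  rewrite /twisted_conj rmorphM /= alpha_i -/(e k) !(mulNr, mulrN, mulrA) opprK.
  have [->|kj] := eqVneq k j; first by rewrite expr1 scaleN1r opprK.
  by rewrite (e_anticomm kj) expr0 scale1r !mulNr opprK.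
by rewrite IHw -scalerAr scalerA -exprD.
Qed.

(* The sum of all products of distinct [twisted_conj j], which kills every word
   with an odd letter. *)
Definition average (s : seq 'I_n) : Cl -> Cl :=
  foldr (fun j f x => f x + twisted_conj j (f x)) id s.

Lemma average_linear s : linear (average s).
Proof.
elim: s => //= j s IHs a x y; rewrite IHs twisted_conj_linear.
by rewrite addrACA -scalerDr.
Qed.

(** [c] is the product over [s] of the factors [1 + (-1) ^+ count_mem j w], which vanish at odd
    counts. *)
Lemma average_word s w : exists2 c : R, average s (basis_word w) = c *: basis_word w &
  has (fun j => odd (count_mem j w)) s -> c = 0.
Proof.
elim: s => [|j s [c sw c0]] /=; first by exists 1; rewrite ?scale1r.
exists (c + c * (-1) ^+ count_mem j w).
  by rewrite sw twisted_conjZ twisted_conj_word scalerA -scalerDl.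
case/orP => [j_odd|/c0 ->]; last by rewrite mul0r addr0.
by rewrite -signr_odd j_odd mulrN1 subrr.
Qed.

Lemma average_scalar x : exists c : R, average (enum 'I_n) x = c%:A.
Proof.
elim/basis_word_span: x => [|a x y [c xc] [d yd]|w].
- exists 0; have := average_linear (enum 'I_n) (-1) 0 0.
  by rewrite !scaler0 scaleN1r !addr0 addNr scale0r.
- by exists (a * c + d); rewrite average_linear xc yd scalerA -scalerDl.
have [c -> c0] := average_word (enum 'I_n) w.
have [w_odd|] := boolP (has (fun j => odd (count_mem j w)) (enum 'I_n)).
  by exists 0; rewrite c0 // !scale0r.
move=> /hasPn w_even; have [|d ->] := basis_word_sqr_count (w := w).
  by move=> j; apply: w_even; rewrite mem_enum.
by exists (c * d); rewrite scalerA.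
Qed.

Lemma average_fixed s x : (forall j, twisted_conj j x = x) ->
  average s x = 2 ^+ size s *: x.
Proof.
move=> x_fix; elim: s => [|j s IHs] /=; first by rewrite scale1r.
rewrite IHs twisted_conjZ x_fix -scalerDl exprS.
by congr (_ *: _); ring.
Qed.

Lemma twisted_centralizer x :
  (forall v, alpha x * i v = i v * x) -> exists c : R, x = c%:A.
Proof.
move=> x_comm; have [c xc] := average_scalar x.
(* Averaging multiplies the fixed point [x] by this power of 2, which is divided out. *)
exists ((2 ^+ size (enum 'I_n))^-1 * c).
rewrite -scalerA -xc average_fixed ?scalerA ?mulVf ?scale1r //.
  by rewrite expf_neq0 // pnatr_eq0.
by move=> j; rewrite /twisted_conj -mulrA x_comm mulrA e_sqr mulN1r opprK.
Qed.

End CliffordAlgebra.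

(** * The twisted adjoint action of Pin and Spin *)

Section PinSpin.
Variables (R : realType) (n : nat) (Cl : unitAlgType R).
Variable i : {linear 'rV[R]_n -> Cl}.
Hypothesis Cl_clifford : is_clifford_algebra (@euclidean_form R n) i.
Variables (alpha : {lrmorphism Cl -> Cl}) (t : {linear Cl -> Cl}).
Hypothesis alphaP : is_grade_involution i alpha.
Hypothesis tP : is_transposition i t.

Let rho := twisted_adjoint i alpha.
Let Gamma := lipschitz_group i alpha.
Let Pin := pin_group i alpha t.
Let Spin := spin_group i alpha t.

Let alpha_i v : alpha (i v) = - i v. Proof. exact: alphaP.2. Qed.

(** * Conjugation and the Lipschitz group *)

Lemma clifford_conjM x y :
  clifford_conj alpha t (x * y) = clifford_conj alpha t y * clifford_conj alpha t x.
Proof. by case: tP => _ _ tM _; rewrite /clifford_conj tM rmorphM. Qed.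

Lemma clifford_conj_scalar a : clifford_conj alpha t a%:A = a%:A.
Proof. by case: tP => _ t1 _ _; rewrite /clifford_conj !linearZ /= t1 rmorph1. Qed.

Lemma clifford_conj1 : clifford_conj alpha t 1 = 1.
Proof. by case: tP => _ t1 _ _; rewrite /clifford_conj t1 rmorph1. Qed.

Lemma clifford_conj_vector v : clifford_conj alpha t (i v) = - i v.
Proof. by case: tP => _ _ _ ti; rewrite /clifford_conj ti. Qed.

Lemma twisted_adjointE x v : Gamma x -> i (rho x v) = alpha x * i v * x^-1.
Proof. move=> [_ /(_ v)[w _ wE]].
by apply: (@xgetPex _ 0 [set z | i z = alpha x * i v * x^-1]); exists w. Qed.

(** Injectivity of [i] makes the vector chosen by [xget] unique, so one explicit witness computes
    it. *)
Lemma twisted_adjoint_eq x v w : alpha x * i v * x^-1 = i w -> rho x v = w.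
Proof.
move=> wE; apply: (clifford_inj Cl_clifford); rewrite -wE.
by apply: (@xgetPex _ 0 [set z | i z = alpha x * i v * x^-1]); exists w.
Qed.

Lemma lipschitz_group1 : Gamma 1.
Proof.
split; first exact: unitr1.
by move=> v; exists v => //; rewrite rmorph1 mul1r invr1 mulr1.
Qed.

Lemma twisted_adjoint1 : rho 1 = id.
Proof.
apply/funext => v; apply: twisted_adjoint_eq.
by rewrite rmorph1 mul1r invr1 mulr1.
Qed.

(** Gives both the closure of [Gamma] under products and the multiplicativity of [rho]. *)
Lemma twisted_adjointM_vector x y v : Gamma x -> Gamma y ->
  alpha (x * y) * i v * (x * y)^-1 = i (rho x (rho y v)).
Proof.
move=> xG yG; rewrite !twisted_adjointE // rmorphM /= invrM; last 2 first.
- exact: xG.1.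
- exact: yG.1.
by rewrite !mulrA.
Qed.

Lemma lipschitz_groupM x y : Gamma x -> Gamma y -> Gamma (x * y).
Proof.
move=> xG yG; split; first by rewrite unitrMl ?xG.1 ?yG.1.
by move=> v; exists (rho x (rho y v)) => //; rewrite twisted_adjointM_vector.
Qed.

Lemma twisted_adjointM x y : Gamma x -> Gamma y -> rho (x * y) = rho x \o rho y.
Proof.
move=> xG yG; apply/funext => v; apply: twisted_adjoint_eq.
exact: twisted_adjointM_vector.
Qed.

(* [w := i (rho x v)] is a vector, so [alpha w = - w] and [w ^+ 2 = - alpha w * w],
   in which [x] cancels. *)
Lemma is_isometry_twisted_adjoint x : Gamma x -> is_isometry (rho x).
Proof.
move=> xG; have [x_unit _] := xG.
have rho_lin : linear (rho x).
  move=> a u v; apply: (clifford_inj Cl_clifford).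
  rewrite linearP !twisted_adjointE // linearP mulrDr mulrDl.
  by rewrite -scalerAr -scalerAl.
have rho_dot v : dot (rho x v) (rho x v) = dot v v.
  have : (- dot (rho x v) (rho x v))%:A = (- dot v v)%:A :> Cl.
    rewrite -!(clifford_mul_vector Cl_clifford).
    rewrite -[X in X * _]opprK -alpha_i twisted_adjointE // !rmorphM /=.
    rewrite (grade_involutionK Cl_clifford alpha_i) alpha_i rmorphV //.
    rewrite !(mulrN, mulNr) opprK !mulrA mulrVK ?rmorph_unit //.
    rewrite -(mulrA x) clifford_mul_vector // -scalerAr mulr1 -scalerAl.
    by rewrite mulrV.
  (* Scalars can be compared in [R] because a ring morphism from a field to a nonzero ring is
     injective. *)
  by move/(fmorph_inj (in_alg Cl))/oppr_inj.
exact: is_isometry_sqr.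
Qed.

(** [rho x] is an isometry, hence bijective on vectors, and its inverse supplies the vectors
    required for [x^-1]. *)
Lemma lipschitz_groupV x : Gamma x -> Gamma x^-1.
Proof.
move=> xG; have [x_unit _] := xG.
have [g _ gK] := is_isometry_bij (is_isometry_twisted_adjoint xG).
split=> [|v]; first by rewrite unitrV.
exists (g v) => //; rewrite -{2}[v]gK twisted_adjointE // rmorphV //.
by rewrite !mulrA mulVr ?rmorph_unit // mul1r invrK mulrVK.
Qed.

(** * The group Pin(n), its kernel and its image *)

Lemma pin_group1 : Pin 1.
Proof.
split; first exact: lipschitz_group1.
by rewrite /clifford_norm clifford_conj1 mulr1.
Qed.

Lemma pin_groupM x y : Pin x -> Pin y -> Pin (x * y).
Proof.
move=> [xG xN] [yG yN]; split; first exact: lipschitz_groupM.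
by rewrite /clifford_norm clifford_conjM mulrA -(mulrA x) [y * _]yN mulr1.
Qed.

(** Norm 1 says that the conjugate of [x] is [x^-1]; anti-multiplicativity then makes [x] the
    conjugate of [x^-1]. *)
Lemma pin_groupV x : Pin x -> Pin x^-1.
Proof.
move=> [xG xN]; split; first exact: lipschitz_groupV.
have [x_unit _] := xG.
have x_conj : clifford_conj alpha t x = x^-1.
  by rewrite -[LHS](mulKr x_unit) [x * _]xN mulr1.
rewrite /clifford_norm.
suff -> : clifford_conj alpha t x^-1 = x by rewrite mulVr.
have xV_conj : clifford_conj alpha t x^-1 * x^-1 = 1.
  by rewrite -{2}x_conj -clifford_conjM mulrV // clifford_conj1.
by rewrite -[LHS](mulrVK x_unit) xV_conj mul1r.
Qed.

Lemma pin_groupN1 : Pin (-1).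
Proof.
have N1V : (-1)^-1 = -1 :> Cl by rewrite invrN invr1.
split; last first.
  rewrite -scaleN1r /clifford_norm clifford_conj_scalar scaleN1r.
  by rewrite mulrNN mulr1.
split=> [|v]; first by rewrite unitrN unitr1.
by exists v => //; rewrite N1V rmorphN1 mulrN1 mulN1r opprK.
Qed.

Lemma pin_kernel : hom_kernel Pin id rho = [set -1; 1].
Proof.
apply/seteqP; split=> [x [[xG xN] rho_x]|x [->|->]]; last 2 first.
- split; first exact: pin_groupN1.
  apply/funext => v; apply: twisted_adjoint_eq.
  by rewrite invrN invr1 rmorphN1 mulrN1 mulN1r opprK.
- by split; [exact: pin_group1|exact: twisted_adjoint1].
have [c xc] : exists c : R, x = c%:A.
  apply: (twisted_centralizer Cl_clifford alpha_i) => v.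
  have := twisted_adjointE v xG; rewrite rho_x /= => ivE.
  by rewrite [in RHS]ivE mulrVK ?xG.1.
move: xN; rewrite xc /clifford_norm clifford_conj_scalar -scalerAl mul1r scalerA.
rewrite -[RHS]scale1r => /(fmorph_inj (in_alg Cl))/eqP; rewrite -expr2 sqrf_eq1.
case/orP => /eqP ->; first by right; rewrite /= scale1r.
by left; rewrite /= scaleN1r.
Qed.

(** [i u] has square [-1] and inverse [- i u], so the action on [v] is [i u * i v * i u], which
    anticommutation turns into the reflection. *)
Lemma twisted_adjoint_unit_vector u :
  dot u u = 1 -> Pin (i u) /\ rho (i u) = reflection u.
Proof.
move=> u1.
have uu : i u * i u = -1 by rewrite clifford_mul_vector // u1 scaleN1r.
have u_unit : i u \is a GRing.unit.
  by apply/unitrP; exists (- i u); rewrite mulNr mulrN uu opprK.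
have uV : (i u)^-1 = - i u.
  by apply: (mulIr u_unit); rewrite mulVr // mulNr uu opprK.
have u_refl v : alpha (i u) * i v * (i u)^-1 = i (reflection u v).
  rewrite alpha_i uV mulNr mulrNN /reflection linearB linearZ /=.
  have /(canRL (addrK _)) -> := clifford_anticomm Cl_clifford u v.
  by rewrite mulrBl -scalerAl mul1r -mulrA uu mulrN1 opprK scaleNr addrC.
split; last by apply/funext => v; exact: twisted_adjoint_eq.
split; last by rewrite /clifford_norm clifford_conj_vector mulrN uu opprK.
by split=> // v; exists (reflection u v).
Qed.

(** The witness is the product of the vectors in [us]; the last clause records its parity, to be
    matched with the determinant. *)
Lemma twisted_adjoint_reflections us : unit_vectors us ->
  exists x, [/\ Pin x, rho x = reflections us & alpha x = (-1) ^+ size us * x].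
Proof.
elim: us => [_|u us IHus /= /andP[/eqP u1 /IHus[x [xP rho_x alpha_x]]]].
  exists 1; split; [exact: pin_group1|exact: twisted_adjoint1|].
  by rewrite rmorph1 mulr1.
have [uP rho_u] := twisted_adjoint_unit_vector u1.
exists (i u * x); split.
- exact: pin_groupM.
- by rewrite (twisted_adjointM uP.1 xP.1) rho_u rho_x.
- rewrite rmorphM /= alpha_i alpha_x exprS mulN1r !mulNr !mulrA.
  by rewrite (commr_sign (i u)).
Qed.

Lemma pin_surj : set_surj Pin (orthogonal_group (@euclidean_form R n)) rho.
Proof.
move=> f /orthogonal_groupP/cartan_dieudonne[us us1 ->].
by have [x [xP rho_x _]] := twisted_adjoint_reflections us1; exists x.
Qed.

(** A product [y] of unit vectors acts as [x] does, so [x] is [y] or [- y] by the kernel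
    computation, and has the parity of [y]. *)
Lemma pin_grade_involution x : Pin x -> alpha x = \det (lin1_mx (rho x)) *: x.
Proof.
move=> xP.
have [us us1 rho_x] := cartan_dieudonne (is_isometry_twisted_adjoint xP.1).
rewrite -/rho in rho_x.
have [y [yP rho_y alpha_y]] := twisted_adjoint_reflections us1.
have [y_unit _] := yP.1.
have : hom_kernel Pin id rho (x * y^-1).
  split; first by apply: pin_groupM => //; exact: pin_groupV.
  have yVP := pin_groupV yP.
  rewrite (twisted_adjointM xP.1 yVP.1) rho_x -rho_y.
  by rewrite -(twisted_adjointM yP.1 yVP.1) mulrV // twisted_adjoint1.
rewrite rho_x det_reflections // pin_kernel.
have alpha_y' : alpha y = (-1) ^+ size us *: y.
  by rewrite alpha_y -signr_odd mulr_sign -[in RHS]signr_odd scaler_sign.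
case=> /= xy; have -> : x = x * y^-1 * y by rewrite mulrVK.
- by rewrite xy mulN1r raddfN /= alpha_y' scalerN.
- by rewrite xy mul1r.
Qed.

Lemma spin_groupE x : Spin x <-> Pin x /\ \det (lin1_mx (rho x)) = 1.
Proof.
split=> [[xP x_even]|[xP x_det]]; last first.
  by split=> //=; rewrite /even_part /= pin_grade_involution // x_det scale1r.
split=> //; have [x_unit _] := xP.1.
(* With [x] nonzero, [x = det *: x] forces the determinant to be 1. *)
have x0 : x != 0 by apply: contraTneq x_unit => ->; rewrite unitr0.
have := pin_grade_involution xP; rewrite (x_even : alpha x = x) => /eqP.
rewrite -[X in X == _]scale1r -subr_eq0 -scalerBl scaler_eq0 (negPf x0) orbF.
by rewrite subr_eq0 => /eqP.
Qed.

(** * The homomorphisms to O(n) and SO(n) *)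

Lemma is_group_pin : is_group Pin *%R 1.
Proof.
split=> [||x y z _ _ _|x _|x _|x xP].
- exact: pin_group1.
- exact: pin_groupM.
- exact: mulrA.
- exact: mul1r.
- exact: mulr1.
- exists x^-1; have [x_unit _] := xP.1.
  by rewrite mulrV // mulVr //; split=> //; exact: pin_groupV.
Qed.

Lemma is_group_spin : is_group Spin *%R 1.
Proof.
split=> [|x y [xP xE] [yP yE]|x y z _ _ _|x _|x _|x [xP xE]].
- by split; [exact: pin_group1|exact: rmorph1].
- split; first exact: pin_groupM.
  by rewrite /even_part /= rmorphM /= (xE : alpha x = x) (yE : alpha y = y).
- exact: mulrA.
- exact: mul1r.
- exact: mulr1.
- exists x^-1; have [x_unit _] := xP.1.
  rewrite mulrV // mulVr //; split=> //; split; first exact: pin_groupV.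
  by rewrite /even_part /= rmorphV //= (xE : alpha x = x).
Qed.

Lemma pin_hom :
  is_group_hom Pin *%R 1 (orthogonal_group (@euclidean_form R n)) comp id rho.
Proof.
split=> [|||x y xP yP].
- exact: is_group_pin.
- exact: is_group_orthogonal.
- by move=> x xP; apply/orthogonal_groupP/is_isometry_twisted_adjoint/xP.1.
- exact: twisted_adjointM xP.1 yP.1.
Qed.

Lemma spin_hom :
  is_group_hom Spin *%R 1 (special_orthogonal_group (@euclidean_form R n)) comp id rho.
Proof.
split=> [|||x y [xP _] [yP _]].
- exact: is_group_spin.
- exact: is_group_special_orthogonal.
- move=> x /spin_groupE[xP x_det]; split=> //.
  exact/orthogonal_groupP/is_isometry_twisted_adjoint/xP.1.
- exact: twisted_adjointM xP.1 yP.1.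
Qed.

Lemma spin_surj :
  set_surj Spin (special_orthogonal_group (@euclidean_form R n)) rho.
Proof.
move=> f [/pin_surj[x xP <-] f_det]; exists x => //.
exact/spin_groupE.
Qed.

Lemma spin_kernel : hom_kernel Spin id rho = [set -1; 1].
Proof.
rewrite -pin_kernel; apply/seteqP; split=> [x [[xP _] rho_x]//|x [xP rho_x]].
by split=> //; apply/spin_groupE; rewrite rho_x lin1_mx_id det1.
Qed.

End PinSpin.

(** * The two-element kernel and the theorem *)

Lemma pm1_isomorphic_Z2 (A : nzRingType) : (-1 : A) != 1 ->
  group_isomorphic [set -1; 1 : A] *%R 1 [set: 'Z_2] +%R 0.
Proof.
(* Only the values at [1] and [-1] matter; [N1] keeps them distinct. *)
move=> N1; exists (fun x : A => if x == 1 then 0 else 1 : 'Z_2).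
- split=> [||x x_pm //|x y].
  + split=> [|x y [->|->] [->|->]|x y z _ _ _|x _|x _|x [->|->]] /=.
    * by right.
    * by right; rewrite mulrNN mulr1.
    * by left; rewrite mulr1.
    * by left; rewrite mul1r.
    * by right; rewrite mulr1.
    * exact: mulrA.
    * exact: mul1r.
    * exact: mulr1.
    * by exists (-1); rewrite mulrNN mulr1; split=> //; left.
    * by exists 1; rewrite mulr1; split=> //; right.
  + split=> // [x y z _ _ _|x _|x _|x _].
    * exact: addrA.
    * exact: add0r.
    * exact: addr0.
    * by exists (- x); rewrite addrN addNr.
  + by move=> [->|->] [->|->]; rewrite ?mulrNN ?mulr1 ?mul1r ?eqxx ?(negPf N1)
      ?addr0 ?add0r //; apply/val_inj.
- split=> //.
  + move=> x y /set_mem[->|->] /set_mem[->|->] //; by rewrite eqxx (negPf N1).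
  + move=> [[|[|//]] k_lt] _.
      by exists 1; [right|rewrite eqxx; apply/val_inj].
    by exists (-1); [left|rewrite (negPf N1); apply/val_inj].
Qed.

Theorem mainTheorem1 (R : realType) (n : nat) (n_ge1 : (1 <= n)%N)
    (Cl : unitAlgType R) (i : {linear 'rV[R]_n -> Cl})
    (Cl_clifford : is_clifford_algebra (@euclidean_form R n) i)
    (alpha : {lrmorphism Cl -> Cl}) (alphaP : is_grade_involution i alpha)
    (t : {linear Cl -> Cl}) (tP : is_transposition i t) :
  let rho := twisted_adjoint i alpha in
  let Pin := pin_group i alpha t in
  let Spin := spin_group i alpha t in
  let On := orthogonal_group (@euclidean_form R n) in
  let SOn := special_orthogonal_group (@euclidean_form R n) in
  [/\ is_group_hom Pin *%R 1 On comp id rho,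
      set_surj Pin On rho,
      hom_kernel Pin id rho = [set -1; 1] &
      group_isomorphic (hom_kernel Pin id rho) *%R 1 [set: 'Z_2] +%R 0] /\
  [/\ is_group_hom Spin *%R 1 SOn comp id rho,
      set_surj Spin SOn rho,
      hom_kernel Spin id rho = [set -1; 1] &
      group_isomorphic (hom_kernel Spin id rho) *%R 1 [set: 'Z_2] +%R 0].
Proof.
(* The signs differ in the ordered field [R], which embeds in [Cl] as the scalars. *)
have N1 : (-1 : Cl) != 1.
  have neq : (-1 : R) != 1 by rewrite lt_eqF // (lt_trans (ltrN10 R)) ?ltr01.
  apply: contra_neq neq => N1; apply: (fmorph_inj (in_alg Cl)).
  by rewrite rmorphN1 rmorph1.
move=> rho Pin Spin On SOn; split; split.
- exact: pin_hom.
- exact: pin_surj.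
- exact: pin_kernel.
- by rewrite pin_kernel //; exact: pm1_isomorphic_Z2.
- exact: spin_hom.
- exact: spin_surj.
- exact: spin_kernel.
- by rewrite spin_kernel //; exact: pm1_isomorphic_Z2.
Qed.
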